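(* Let $G$ be a unicyclic graph of Type $II$, let $C$ be its cycle, and let $T_1,\ldots,T_k$ be the connected components of $G-C$, so that $G-C=\bigcup_{i=1}^{k}T_i$. Then $$\alpha(G)=\left\lfloor\frac{|V(C)|}{2}\right\rfloor+\sum_{i=1}^{k}\left(|Supp(T_i)|+\frac{|V(\mathcal{F}_N(T_i))|}{2}\right).$$
   Context: All graphs are finite and simple. A unicyclic graph is a connected graph containing exactly one cycle. For a graph $H$ with adjacency matrix $A(H)$, $\mathcal{N}(H)=\{x\in\mathbb{R}^{V(H)}: A(H)x=0\}$ and the support of $H$ is $Supp(H)=\{u\in V(H): x_u\neq 0 \text{ for some } x\in\mathcal{N}(H)\}$. For a subgraph $H$ of $G$, $G-H$ is the subgraph of $G$ induced by $V(G)\setminus V(H)$. $\alpha(G)$ denotes the independence number of $G$ (the maximum cardinality of an independent set). For a unicyclic graph $G$ with cycle $C$ and $v\in V(C)$, the pendant tree $G\{v\}$ of $G$ at $v$ is the induced connected subgraph of $G$ with the maximum possible number of vertices which contains $v$ and no other vertex of $C$ (it may consist of $v$ alone). The vertex $v$ is called mismatched in $G\{v\}$ if some maximum matching of $G\{v\}$ does not saturate $v$ (if $G\{v\}$ consists of a single vertex, $v$ is mismatched), and matched in $G\{v\}$ otherwise. $G$ is of Type $I$ if some vertex $v\in V(C)$ is matched in $G\{v\}$; otherwise $G$ is of Type $II$. For a tree $T$, the $S$-forest $\mathcal{F}_S(T)$ is the subgraph of $T$ induced by the closed neighborhood $N[Supp(T)]$, i.e. by $Supp(T)$ together with all neighbors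 of vertices of $Supp(T)$; the $N$-forest is $\mathcal{F}_N(T)=T-\mathcal{F}_S(T)$. *)

(* Defs.v *)
From mathcomp Require Import all_boot all_order all_algebra.
From mathcomp Require Import boolp reals.
Set Implicit Arguments.
Unset Strict Implicit.
Unset Printing Implicit Defensive.
Import GRing.Theory Num.Theory.
Local Open Scope ring_scope.

(* A finite simple graph is a symmetric irreflexive relation [e] on a finType. *)
(* An induced subgraph is represented by its vertex set [S : {set T}]; the     *)
(* whole graph is [S = [set: T]].                                              *)

Definition adj_in (T : finType) (e : rel T) (S : {set T}) : rel T :=
  [rel x y | [&& x \in S, y \in S & e x y]].

Definition edges_in (T : finType) (e : rel T) (S : {set T}) : {set {set T}} :=
  [set [set p.1; p.2] | p : T * T & adj_in e S p.1 p.2].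

Definition connected_in (T : finType) (e : rel T) (S : {set T}) : bool :=
  (S != set0) && [forall x in S, forall y in S, connect (adj_in e S) x y].

Definition components (T : finType) (e : rel T) (S : {set T}) : {set {set T}} :=
  equivalence_partition (connect (adj_in e S)) S.

Definition independent (T : finType) (e : rel T) (A : {set T}) : bool :=
  [forall x in A, forall y in A, ~~ e x y].

Definition alpha (T : finType) (e : rel T) : nat :=
  (\max_(A : {set T} | independent e A) #|A|)%N.

Definition graph_cycle (T : finType) (e : rel T) (c : seq T) : Prop :=
  (2 < size c)%N /\ ucycle e c.

(* Two vertex sequences describe the same cycle (as a subgraph) exactly when   *)
(* they have the same edge set.                                                *)
Definition cycle_edges (T : finType) (c : seq T) : {set {set T}} :=
  [set [set x; next c x] | x in c].

Definition unicyclic (T : finType) (e : rel T) : Prop :=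
  connected_in e [set: T] /\
  exists2 c : seq T, graph_cycle e c &
    forall c' : seq T, graph_cycle e c' -> cycle_edges c' = cycle_edges c.

Definition matching (T : finType) (e : rel T) (S : {set T})
    (M : {set {set T}}) : bool :=
  (M \subset edges_in e S) && trivIset M.

Definition maximum_matching (T : finType) (e : rel T) (S : {set T})
    (M : {set {set T}}) : Prop :=
  matching e S M /\
  forall M' : {set {set T}}, matching e S M' -> (#|M'| <= #|M|)%N.

(* [cover M] is the set of vertices saturated by [M]. *)
Definition mismatched (T : finType) (e : rel T) (S : {set T}) (v : T) : Prop :=
  exists2 M : {set {set T}}, maximum_matching e S M & v \notin cover M.

Definition matched (T : finType) (e : rel T) (S : {set T}) (v : T) : Prop :=
  ~ mismatched e S v.

(* Meaningful for [v \in C], in which case [[set v]] satisfies the constraint. *)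
Definition pendant_tree (T : finType) (e : rel T) (C : {set T}) (v : T) :
    {set T} :=
  [arg max_(S > [set v] | connected_in e S && (S :&: C == [set v])) #|S|]%N.

Definition typeI (T : finType) (e : rel T) (C : {set T}) : Prop :=
  exists2 v : T, v \in C & matched e (pendant_tree e C v) v.

Definition typeII (T : finType) (e : rel T) (C : {set T}) : Prop :=
  ~ typeI e C.

Definition adjmx (R : realType) (T : finType) (e : rel T) (S : {set T}) :
    'M[R]_#|S| :=
  \matrix_(i, j) (e (enum_val i) (enum_val j))%:R.

Definition supp (R : realType) (T : finType) (e : rel T) (S : {set T}) :
    {set T} :=
  [set enum_val i | i : 'I_#|S| &
     `[< exists2 x : 'cV[R]_#|S|, adjmx R e S *m x = 0 & x i 0 != 0 >]].

Definition S_forest (R : realType) (T : finType) (e : rel T) (S : {set T}) :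
    {set T} :=
  [set u in S | (u \in supp R e S) || [exists v in supp R e S, e v u]].

Definition N_forest (R : realType) (T : finType) (e : rel T) (S : {set T}) :
    {set T} :=
  S :\: S_forest R e S.

(* Main.v *)
(** Write [alpha] and [nu] for the independence and matching numbers of induced
    subgraphs, so that [alpha(S) + nu(S) <= |S|] always.  Deleting a leaf of a
    forest together with its neighbour lowers [alpha] by one, [nu] by at least
    one and [2 |Supp| + |F_N|] by two; by induction every forest [F] satisfies
    [alpha(F) + nu(F) = |F|] and [2 alpha(F) = 2 |Supp(F)| + |F_N(F)|].

    The only cycle of [G] is [C], so [G - C] is a forest and each component [K]
    of [G - C] has at most one vertex [u] adjacent to [C].  In Type II the
    neighbour of [u] on [C] is missed by a maximum matching of its pendant tree,
    which forces every maximum matching of [K] to saturate [u]; then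
    [nu(K - u) < nu(K)], hence [alpha(K - u) = alpha(K)].  A maximum independent
    set of [G - C] can thus be chosen among the vertices not adjacent to [C],
    which gives [alpha(G) = alpha(C) + \sum_K alpha(K)]. *)

Require Import Defs.
From mathcomp Require Import all_boot all_order all_algebra.
From mathcomp Require Import boolp reals zify.
Set Implicit Arguments.
Unset Strict Implicit.
Unset Printing Implicit Defensive.
Import GRing.Theory Num.Theory.

Lemma card_setI_partition (T : finType) (P : {set {set T}}) (A S : {set T}) :
  partition P S -> #|A :&: S| = \sum_(K in P) #|A :&: K|.
Proof.
move=> partP.
have card_sum B : #|A :&: B| = \sum_(x in B | x \in A) 1.
  by rewrite -sum1_card; apply: eq_bigl => x; rewrite inE andbC.
rewrite card_sum (set_partition_big_cond _ partP).
by apply: eq_bigr => K _; rewrite card_sum.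
Qed.

Lemma disjoint_setD (T : finType) (A B : {set T}) : [disjoint A & B :\: A].
Proof. by rewrite disjoint_sym disjoints_subset setDE subsetIr. Qed.

Definition nbhd (T : finType) (e : rel T) (A : {set T}) : {set T} :=
  [set u | [exists v in A, e v u]].

Definition anticomplete (T : finType) (e : rel T) (A B : {set T}) : Prop :=
  {in A & B, forall x y, ~~ e x y}.

Section Adjacency.
Variables (T : finType) (e : rel T).
Hypothesis e_sym : symmetric e.
Implicit Types (A B : {set T}).

Lemma nbhdP A u : reflect (exists2 v, v \in A & e v u) (u \in nbhd e A).
Proof. by rewrite inE; apply: exists_inP. Qed.

Lemma nbhdU A B : nbhd e (A :|: B) = nbhd e A :|: nbhd e B.
Proof.
apply/setP => z; apply/nbhdP/setUP => [[v /setUP[vA|vB] vz]|].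
- by left; apply/nbhdP; exists v.
- by right; apply/nbhdP; exists v.
by move=> [] /nbhdP[v vAB vz]; exists v; rewrite // inE vAB ?orbT.
Qed.

Lemma anticompleteC A B : anticomplete e A B -> anticomplete e B A.
Proof. by move=> acAB x y xB yA; rewrite e_sym acAB. Qed.

Lemma anticompleteS A A' B B' : A' \subset A -> B' \subset B ->
  anticomplete e A B -> anticomplete e A' B'.
Proof. by move=> /subsetP sA /subsetP sB acAB x y /sA xA /sB; apply: acAB. Qed.

Lemma anticomplete_nbhd A B : anticomplete e A (B :\: nbhd e A).
Proof.
move=> x y xA /setDP[_]; apply: contra => xy.
by apply/nbhdP; exists x.
Qed.

End Adjacency.

Section Connectivity.
Variables (T : finType) (e : rel T).
Hypothesis e_sym : symmetric e.
Implicit Types (S K : {set T}).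

Lemma connect_in_sym S : connect_sym (adj_in e S).
Proof. by apply: sym_connect_sym => x y; rewrite /adj_in /= e_sym andbCA. Qed.

Lemma connect_inS S S' : S \subset S' ->
  subrel (connect (adj_in e S)) (connect (adj_in e S')).
Proof.
move=> /subsetP sub; apply: connect_sub => x y /and3P[xS yS xy].
by apply: connect1; rewrite /adj_in /= !sub.
Qed.

Lemma connect_in_path S x y : x \in S -> connect (adj_in e S) x y ->
  exists p, [/\ path e x p, uniq (x :: p), last x p = y & {subset x :: p <= S}].
Proof.
move=> xS /connectP[p0 p0P ->]; case: (shortenP p0P) => p pP p_uniq _.
exists p; split=> //; first by apply: sub_path pP => a b /and3P[].
have closedS : closed (adj_in e S) (mem S).
  by move=> a b /and3P[aS bS _]; rewrite [LHS]aS.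
by move=> z /(path_connect pP)/(closed_connect closedS) <-.
Qed.

Lemma connected_inU1 S x y : connected_in e S -> x \in S -> e x y ->
  connected_in e (y |: S).
Proof.
move=> /andP[_ /'forall_in_forall_inP conS] xS xy.
have from_x z : z \in y |: S -> connect (adj_in e (y |: S)) x z.
  move=> /setU1P[->|zS]; last first.
    exact: connect_inS (subsetUr _ _) _ _ (conS _ xS _ zS).
  by apply: connect1; rewrite /adj_in /= !in_setU1 eqxx xS orbT.
apply/andP; split; first by apply/set0Pn; exists y; rewrite setU11.
apply/'forall_in_forall_inP => a aS b bS; apply: connect_trans (from_x b bS).
by rewrite connect_in_sym from_x.
Qed.

Lemma component_sub S K : K \in components e S -> K \subset S.
Proof.
by move=> /imsetP[x _ ->]; apply/subsetP => z; rewrite inE => /andP[].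
Qed.

Lemma component_partition S : partition (components e S) S.
Proof.
apply: equivalence_partitionP => x y z _ _ _; split=> [|xy].
  exact: connect0.
exact: same_connect (connect_in_sym S) _ _ xy _.
Qed.

Lemma mem_component S K x y : K \in components e S -> x \in K ->
  (y \in K) = (y \in S) && connect (adj_in e S) x y.
Proof.
move=> /imsetP[z _ ->]; rewrite !inE => /andP[_ zx].
by rewrite (same_connect (connect_in_sym S) zx).
Qed.

Lemma component_anticomplete S K : K \in components e S ->
  anticomplete e K (S :\: K).
Proof.
move=> cK x y xK /setDP[yS]; apply: contra => xy.
have xS : x \in S := subsetP (component_sub cK) x xK.
by rewrite (mem_component y cK xK) yS connect1 //= /adj_in /= xS yS.
Qed.

Lemma components_pairwise_anticomplete S :
  {in components e S &, forall K K', K != K' -> anticomplete e K K'}.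
Proof.
move=> K K' cK cK' neqKK'.
apply: (anticompleteS (subxx K) _ (component_anticomplete cK)).
rewrite subsetD (component_sub cK') disjoint_sym.
by have /trivIsetP := partition_trivIset (component_partition S); apply.
Qed.

End Connectivity.

Definition alpha_in (T : finType) (e : rel T) (S : {set T}) : nat :=
  \max_(A : {set T} | (A \subset S) && independent e A) #|A|.

Section IndependenceNumber.
Variables (T : finType) (e : rel T).
Hypothesis e_sym : symmetric e.
Implicit Types (S A B : {set T}).

Lemma independentP A : reflect (anticomplete e A A) (independent e A).
Proof.
apply: (iffP 'forall_in_forall_inP) => indA x.
  by move=> y xA; apply: indA.
by move=> xA y; apply: indA.
Qed.

Lemma independentS A B : A \subset B -> independent e B -> independent e A.
Proof.
by move=> sub /independentP indB; apply/independentP/(anticompleteS sub sub).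
Qed.

Lemma independentU A B : independent e A -> independent e B ->
  anticomplete e A B -> independent e (A :|: B).
Proof.
move=> /independentP indA /independentP indB acAB; apply/independentP.
move=> x y /setUP[] xAB /setUP[] yAB; [exact: indA|exact: acAB| |exact: indB].
exact: anticompleteC acAB _ _ xAB yAB.
Qed.

Lemma leq_alpha_in S A : A \subset S -> independent e A -> #|A| <= alpha_in e S.
Proof. by move=> AS indA; apply: leq_bigmax_cond; rewrite AS. Qed.

Lemma alpha_inP S : exists2 A : {set T}, (A \subset S) && independent e A
  & #|A| = alpha_in e S.
Proof.
have ind0 : (set0 \subset S) && independent e set0.
  by rewrite sub0set; apply/independentP => x y; rewrite inE.
by rewrite /alpha_in (bigmax_eq_arg set0) //; case: arg_maxnP => // A; exists A.
Qed.

Lemma alpha_in_setT : alpha_in e [set: T] = alpha e.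
Proof. by apply: eq_bigl => A; rewrite subsetT. Qed.

Lemma alpha_inS S S' : S \subset S' -> alpha_in e S <= alpha_in e S'.
Proof.
move=> sub; have [A /andP[AS indA] <-] := alpha_inP S.
exact: leq_alpha_in (subset_trans AS sub) indA.
Qed.

Lemma alpha_in_independent S : independent e S -> alpha_in e S = #|S|.
Proof.
move=> indS; apply/eqP; rewrite eqn_leq leq_alpha_in // andbT.
by apply/bigmax_leqP => A /andP[AS _]; apply: subset_leq_card.
Qed.

Lemma leq_alpha_inU A B : alpha_in e (A :|: B) <= alpha_in e A + alpha_in e B.
Proof.
have [I /andP[IAB indI] <-] := alpha_inP (A :|: B).
have leqI D : #|I :&: D| <= alpha_in e D.
  apply: leq_alpha_in; first exact: subsetIr.
  exact: independentS (subsetIl _ _) indI.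
by rewrite -(setIidPl IAB) setIUr (leq_trans (leq_card_setU _ _)) // leq_add.
Qed.

Lemma alpha_inU A B : [disjoint A & B] -> anticomplete e A B ->
  alpha_in e (A :|: B) = alpha_in e A + alpha_in e B.
Proof.
move=> disAB acAB; apply/eqP; rewrite eqn_leq leq_alpha_inU /=.
have [I /andP[IA indI] <-] := alpha_inP A.
have [J /andP[JB indJ] <-] := alpha_inP B.
have /leqifP := leq_card_setU I J; rewrite (disjointW IA JB disAB) => /eqP <-.
apply: leq_alpha_in; first exact: setUSS.
exact: independentU indI indJ (anticompleteS IA JB acAB).
Qed.

Lemma alpha_in_partition (P : {set {set T}}) S A : partition P S ->
    {in P &, forall K K', K != K' -> anticomplete e K K'} -> A \subset S ->
  alpha_in e A = \sum_(K in P) alpha_in e (A :&: K).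
Proof.
move=> partP acP AS; apply/eqP; rewrite eqn_leq; apply/andP; split.
  have [I /andP[IA indI] <-] := alpha_inP A.
  rewrite -(setIidPl (subset_trans IA AS)) (card_setI_partition I partP).
  apply: leq_sum => K _; apply: leq_alpha_in; first exact: setSI.
  exact: independentS (subsetIl _ _) indI.
have /fin_all_exists2[I IP alphaI] := fun K : {set T} => alpha_inP (A :&: K).
have IAK K : I K \subset A :&: K by case/andP: (IP K).
pose J := \bigcup_(K in P) I K.
have JA : J \subset A.
  by apply/bigcupsP => K _; apply: subset_trans (IAK K) (subsetIl _ _).
have indJ : independent e J.
  apply/independentP => x y /bigcupP[K PK xI] /bigcupP[K' PK' yI].
  have [eqK|neqK] := eqVneq K K'.
    by have /andP[_ /independentP] := IP K; apply; rewrite // eqK.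
  have /setIP[_ xK] := subsetP (IAK K) _ xI.
  have /setIP[_ yK'] := subsetP (IAK K') _ yI.
  exact: acP neqK _ _ xK yK'.
apply: leq_trans (leq_alpha_in JA indJ).
rewrite -(setIidPl (subset_trans JA AS)) (card_setI_partition J partP).
apply: leq_sum => K PK; rewrite -alphaI; apply: subset_leq_card.
by rewrite subsetI bigcup_sup //= (subset_trans (IAK K) (subsetIr _ _)).
Qed.

End IndependenceNumber.

Definition nu_in (T : finType) (e : rel T) (S : {set T}) : nat :=
  \max_(M : {set {set T}} | matching e S M) #|M|.

Section MatchingNumber.
Variables (T : finType) (e : rel T).
Hypothesis e_sym : symmetric e.
Implicit Types (S A B K : {set T}) (M : {set {set T}}).

Lemma edges_inP S m :
  reflect (exists x y, m = [set x; y] /\ adj_in e S x y) (m \in edges_in e S).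
Proof.
apply: (iffP imsetP) => [[[x y]]|[x [y [-> xy]]]].
  by rewrite inE; exists x, y.
by exists (x, y); rewrite ?inE.
Qed.

Lemma mem_edges_in S m :
  (m \in edges_in e S) = (m \in edges_in e [set: T]) && (m \subset S).
Proof.
apply/edges_inP/andP => [[x [y [-> /and3P[xS yS xy]]]]|].
  rewrite subUset !sub1set xS yS; split=> //.
  by apply/edges_inP; exists x, y; rewrite /adj_in /= !inE.
move=> [/edges_inP[x [y [-> /and3P[_ _ xy]]]]].
rewrite subUset !sub1set => /andP[xS yS].
by exists x, y; rewrite /adj_in /= xS yS.
Qed.

Lemma edges_in_sub S m : m \in edges_in e S -> m \subset S.
Proof. by rewrite mem_edges_in => /andP[]. Qed.

Lemma edges_inS S S' : S \subset S' -> edges_in e S \subset edges_in e S'.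
Proof.
move=> sub; apply/subsetP => m.
rewrite (mem_edges_in S) (mem_edges_in S') => /andP[-> mS].
exact: subset_trans mS sub.
Qed.

Lemma matching_sub_cover S M : matching e S M -> cover M \subset S.
Proof.
by move=> /andP[/subsetP sM _]; apply/bigcupsP => m /sM; apply: edges_in_sub.
Qed.

Lemma matching_partition S M : matching e S M -> partition M (cover M).
Proof.
move=> /andP[/subsetP sM tM]; rewrite /partition eqxx tM /=.
apply/negP => /sM/edges_inP[x [y [/setP/(_ x)]]].
by rewrite !inE eqxx.
Qed.

Lemma matchingD1 S v M :
  matching e (S :\ v) M = matching e S M && (v \notin cover M).
Proof.
rewrite /matching andbAC; congr (_ && _).
apply/subsetP/andP => [sM|[/subsetP sM vM] m mM].
  split; first by apply/subsetP => m /sM/(subsetP (edges_inS (subD1set S v))).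
  apply/bigcupP => -[m /sM/edges_in_sub/subsetP mS vm].
  by have := mS v vm; rewrite !inE eqxx.
have := sM m mM; rewrite (mem_edges_in S) (mem_edges_in (S :\ v)) subsetD1.
move=> /andP[-> ->] /=.
by apply: contra vM => vm; apply/bigcupP; exists m.
Qed.

Lemma leq_nu_in S M : matching e S M -> #|M| <= nu_in e S.
Proof. exact: leq_bigmax_cond. Qed.

Lemma nu_inP S : exists2 M, matching e S M & #|M| = nu_in e S.
Proof.
have match0 : matching e S set0.
  by rewrite /matching sub0set; apply/trivIsetP => A B; rewrite inE.
by rewrite /nu_in (bigmax_eq_arg set0) //; case: arg_maxnP => // M; exists M.
Qed.

Lemma nu_inS S S' : S \subset S' -> nu_in e S <= nu_in e S'.
Proof.
move=> sub; have [M /andP[sM tM] <-] := nu_inP S; apply: leq_nu_in.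
by rewrite /matching tM (subset_trans sM) // edges_inS.
Qed.

Lemma leq_add_nu_in A B : [disjoint A & B] ->
  nu_in e A + nu_in e B <= nu_in e (A :|: B).
Proof.
move=> disAB; have [M mM <-] := nu_inP A; have [N mN <-] := nu_inP B.
have [/andP[sM tM] /andP[sN tN]] := (mM, mN).
have disjoint_covers : [disjoint cover M & cover N].
  exact: disjointW (matching_sub_cover mM) (matching_sub_cover mN) disAB.
have disMN : [disjoint M & N].
  rewrite -setI_eq0; apply/set0Pn => -[m /setIP[Mm Nm]].
  have /set0Pn[x xm] := partition_neq0 (matching_partition mM) Mm.
  have xM : x \in cover M by apply/bigcupP; exists m.
  have /negP[] : x \notin cover N by rewrite (disjointFr disjoint_covers xM).
  by apply/bigcupP; exists m.
have /leqifP := leq_card_setU M N; rewrite disMN => /eqP <-; apply: leq_nu_in.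
rewrite /matching trivIsetU // subUset andbT.
rewrite (subset_trans sM) ?(subset_trans sN) // edges_inS ?subsetUl //.
exact: subsetUr.
Qed.

Lemma leq_nu_inU A B : anticomplete e A B ->
  nu_in e (A :|: B) <= nu_in e A + nu_in e B.
Proof.
move=> acAB; have [M /andP[/subsetP sM tM] <-] := nu_inP (A :|: B).
have M_split : M \subset (M :&: edges_in e A) :|: (M :&: edges_in e B).
  apply/subsetP => m mM; rewrite -setIUr !inE mM /=.
  have /edges_inP[x [y [-> /and3P[xAB yAB xy]]]] := sM m mM.
  have edge_in (D : {set T}) :
      x \in D -> y \in D -> [set x; y] \in edges_in e D.
    by move=> xD yD; apply/edges_inP; exists x, y; rewrite /adj_in /= xD yD.
  case/setUP: xAB yAB => xAB /setUP[] yAB.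
  - by rewrite edge_in.
  - by have := acAB x y xAB yAB; rewrite xy.
  - by have := acAB y x yAB xAB; rewrite e_sym xy.
  - by rewrite [_ || _]orbC edge_in.
apply: leq_trans (subset_leq_card M_split) (leq_trans (leq_card_setU _ _) _).
rewrite leq_add // leq_nu_in // /matching subsetIr.
  by rewrite (trivIsetS _ tM) // subsetIl.
by rewrite (trivIsetS _ tM) // subsetIl.
Qed.

Lemma ltn_nu_inD_edge S p q : adj_in e S p q ->
  nu_in e (S :\: [set p; q]) < nu_in e S.
Proof.
move=> /and3P[pS qS pq].
have pqS : [set p; q] \subset S by rewrite subUset !sub1set pS.
have nu_pq : 0 < nu_in e [set p; q].
  rewrite -(cards1 [set p; q]); apply: leq_nu_in.
  rewrite /matching trivIset1 sub1set andbT; apply/edges_inP; exists p, q.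
  by rewrite /adj_in /= set21 set22.
rewrite -add1n; apply: leq_trans (leq_add nu_pq (leqnn _)) _.
apply: leq_trans (leq_add_nu_in (disjoint_setD _ _)) _.
by rewrite nu_inS // subUset pqS subsetDl.
Qed.

Lemma leq_add_alpha_nu S : alpha_in e S + nu_in e S <= #|S|.
Proof.
have [I /andP[IS /independentP indI] <-] := alpha_inP e S.
have [M mM <-] := nu_inP S.
rewrite -(cardsID I S) (setIidPr IS) leq_add2l.
apply: leq_trans (subset_leq_card (setSD I (matching_sub_cover mM))).
rewrite setDE setIC (card_setI_partition _ (matching_partition mM)) -sum1_card.
apply: leq_sum => m Mm; rewrite card_gt0.
have /andP[/subsetP/(_ m Mm)/edges_inP[x [y [-> /and3P[_ _ xy]]]] _] := mM.
apply/set0Pn; have [xI|xI] := boolP (x \in I); last first.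
  by exists x; rewrite !inE eqxx xI.
exists y; rewrite in_setI in_setC set22 andbT.
by apply: contraL xy => /(indI x y xI).
Qed.

Lemma mismatched_nu_in S v : mismatched e S v <-> nu_in e (S :\ v) = nu_in e S.
Proof.
split=> [[M [mM maxM] vM]|nuE].
  apply/eqP; rewrite eqn_leq nu_inS ?subD1set //=.
  apply: (@leq_trans #|M|); last by rewrite leq_nu_in // matchingD1 mM.
  by have [N mN <-] := nu_inP S; apply: maxM.
have [M] := nu_inP (S :\ v); rewrite nuE matchingD1 => /andP[mM vM] cardM.
by exists M => //; split=> // N /leq_nu_in; rewrite cardM.
Qed.

(* Otherwise the edge [uv], a maximum matching of [K] missing [u] and one of the
   rest of [S :\ v] would together exceed the maximum matchings of [S]. *)
Lemma mismatched_neighbour_matched S K u v : v \in S -> mismatched e S v ->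
    K \subset S :\ v -> anticomplete e K (S :\ v :\: K) -> u \in K -> e u v ->
  matched e K u.
Proof.
move=> vS /mismatched_nu_in nuSv KSv acK uK uv /mismatched_nu_in nuKu.
have /andP[KS vK] : (K \subset S) && (v \notin K) by rewrite -subsetD1.
have uS := subsetP KS u uK.
have : nu_in e (S :\: [set u; v]) < nu_in e S.
  by apply: ltn_nu_inD_edge; apply/and3P.
have -> : S :\: [set u; v] = (K :\ u) :|: (S :\ v :\: K).
  apply/setP => z; rewrite !inE negb_or.
  have [zK|zK] /= := boolP (z \in K); last first.
    by rewrite andbF /=; case: eqVneq => //= zu; rewrite zu uK in zK.
  rewrite (subsetP KS) // orbF !andbT; case: eqVneq => //= _.
  by apply: contraNneq vK => <-.
rewrite ltnNge => /negP[]; rewrite -nuSv -{1}(setID (S :\ v) K) (setIidPr KSv).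
apply: leq_trans (leq_nu_inU acK) _; rewrite -nuKu; apply: leq_add_nu_in.
exact: disjointWl (subD1set K u) (disjoint_setD _ _).
Qed.

End MatchingNumber.

Definition acyclic_in (T : finType) (e : rel T) (S : {set T}) : Prop :=
  forall c : seq T, graph_cycle e c -> ~ {subset c <= S}.

Definition leaf_in (T : finType) (e : rel T) (S : {set T}) (p q : T) : bool :=
  adj_in e S p q && [forall z in S, e p z ==> (z == q)].

Section Forest.
Variables (T : finType) (e : rel T).
Hypotheses (e_sym : symmetric e) (e_irr : irreflexive e).
Implicit Types (S A B : {set T}) (M : {set {set T}}).

Lemma acyclic_inS S S' : S' \subset S -> acyclic_in e S -> acyclic_in e S'.
Proof.
by move=> /subsetP sub acS c c_cycle cS'; apply: (acS c) => // x /cS' /sub.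
Qed.

Lemma disjoint_links_cycle A B a a' b b' :
    [disjoint A & B] -> a \in A -> b \in B ->
    connect (adj_in e A) a a' -> connect (adj_in e B) b b' ->
    e a' b -> e b' a -> (a != a') || (b != b') ->
  exists2 c, graph_cycle e c & (a \in c) /\ {subset c <= A :|: B}.
Proof.
move=> disAB aA bB /(connect_in_path aA)[p [pP p_uniq <- pA]].
move=> /(connect_in_path bB)[q [qP q_uniq <- qB]] ab ba neq.
exists ((a :: p) ++ (b :: q)); last first.
  split=> [|z]; first by rewrite mem_head.
  by rewrite mem_cat in_setU => /orP[/pA|/qB] ->; rewrite ?orbT.
split.
  rewrite size_cat /= addnS addSn !ltnS.
  case: p q neq {pP p_uniq pA qP q_uniq qB ab ba} => [|? ?] [|? ?] //=.
  by rewrite !eqxx.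
apply/andP; split.
  by rewrite /= rcons_cat cat_path pP /= ab rcons_path qP ba.
rewrite cat_uniq p_uniq q_uniq andbT; apply/hasPn => z /qB zB.
by apply/negP => /pA zA; rewrite (disjointFr disAB zA) in zB.
Qed.

Lemma leaf_inP S p q :
  reflect [/\ p \in S, q \in S, e p q & {in S, forall z, e p z -> z = q}]
          (leaf_in e S p q).
Proof.
apply: (iffP andP) => [[/and3P[pS qS pq] /forall_inP onlyq]|[pS qS pq onlyq]].
  by split=> // z zS pz; apply/eqP; have := onlyq z zS; rewrite pz.
split; first exact/and3P.
by apply/forall_inP => z zS; apply/implyP => /(onlyq z zS) ->.
Qed.

Lemma acyclic_neighbour_notin_path S x y z p : acyclic_in e S ->
    path e x (y :: p) -> uniq [:: x, y & p] -> {subset [:: x, y & p] <= S} ->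
    e x z -> z != y ->
  z \notin [:: x, y & p].
Proof.
move=> acS pP p_uniq pS xz zy; rewrite !in_cons (negbTE zy) /= negb_or.
apply/andP; split; first by apply: contraTneq xz => ->; rewrite e_irr.
apply/negP => zp; case/path.splitP: zp pP p_uniq pS => p1 p2.
rewrite -cat_cons -!cat_cons cat_path => /andP[p1P _].
rewrite cat_uniq => /andP[p1_uniq _] pS.
apply: (acS [:: x, y & rcons p1 z]) => [|w wp]; last first.
  by apply: pS; rewrite mem_cat wp.
split; first by rewrite /= size_rcons.
by apply/andP; split=> //=; rewrite rcons_path last_rcons (e_sym z) xz andbT.
Qed.

Lemma acyclic_leaf S : acyclic_in e S -> ~~ independent e S ->
  exists p q, leaf_in e S p q.
Proof.
move=> acS /forall_inPn[x xS] /forall_inPn[y yS]; rewrite negbK => xy.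
(* A leaf is the end of a path that can no longer be extended. *)
have path_leaf n a b s : path e a (b :: s) -> uniq [:: a, b & s] ->
    {subset [:: a, b & s] <= S} -> #|S| < size s + n ->
    exists p q, leaf_in e S p q.
  elim: n a b s => [|n IHn] a b s sP s_uniq sS ltS.
    have : size [:: a, b & s] <= #|S|.
      by rewrite -(card_uniqP s_uniq); apply/subset_leq_card/subsetP.
    by move: ltS => /=; lia.
  have [leaf_ab|] := boolP (leaf_in e S a b); first by exists a, b.
  have aS : a \in S by apply: sS; rewrite mem_head.
  have bS : b \in S by apply: sS; rewrite !inE eqxx orbT.
  have ab : e a b by case/andP: sP.
  rewrite negb_and /adj_in /= aS bS ab => /forall_inPn[z zS].
  rewrite negb_imply => /andP[az zb].
  have z_notin := acyclic_neighbour_notin_path acS sP s_uniq sS az zb.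
  apply: (IHn z a (b :: s)); rewrite ?addSnnS //=.
  - by rewrite e_sym az.
  - by rewrite z_notin.
  - by move=> w /predU1P[->|/sS].
apply: (path_leaf #|S|.+1 x y [::]); rewrite /= ?xy ?add0n //.
  by rewrite inE andbT; apply: contraTneq xy => ->; rewrite e_irr.
by move=> w; rewrite !inE => /orP[] /eqP ->.
Qed.

Lemma forest_ind (P : {set T} -> Prop) :
    (forall S, independent e S -> P S) ->
    (forall S p q, acyclic_in e S -> leaf_in e S p q ->
      P (S :\: [set p; q]) -> P S) ->
  forall S, acyclic_in e S -> P S.
Proof.
move=> P_indep P_leaf S; have [n] := ubnP #|S|.
elim: n S => // n IHn S /ltnSE leSn acS.
have [/P_indep //|dep] := boolP (independent e S).
have [p [q leaf_pq]] := acyclic_leaf acS dep.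
have /leaf_inP[pS _ _ _] := leaf_pq.
apply: (P_leaf S p q) => //; apply: IHn; last first.
  exact: acyclic_inS (subsetDl _ _) acS.
apply: leq_trans leSn; apply/proper_card/properP; split; first exact: subsetDl.
by exists p; rewrite // !inE eqxx.
Qed.

Section Leaf.
Variables (S : {set T}) (p q : T).
Hypothesis leaf_pq : leaf_in e S p q.

Let S' := S :\: [set p; q].

Lemma leaf_neq : p != q.
Proof.
have /leaf_inP[_ _ pq _] := leaf_pq.
by apply: contraTneq pq => ->; rewrite e_irr.
Qed.

Lemma leaf_sub : [set p; q] \subset S.
Proof.
by have /leaf_inP[pS qS _ _] := leaf_pq; rewrite subUset !sub1set pS.
Qed.

Lemma card_leaf : #|S| = #|S'|.+2.
Proof.
by rewrite -(cardsID [set p; q] S) (setIidPr leaf_sub) cards2 leaf_neq.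
Qed.

Lemma leaf_anticomplete : anticomplete e [set p] S'.
Proof.
have /leaf_inP[_ _ _ onlyq] := leaf_pq.
move=> _ z /set1P -> /setDP[zS]; apply: contra => pz.
by rewrite (onlyq z zS pz) set22.
Qed.

Lemma leaf_setD_closed_nbhd : S :\: ([set p] :|: nbhd e [set p]) = S'.
Proof.
have /leaf_inP[_ _ pq onlyq] := leaf_pq; apply/setP => z.
rewrite !in_setD !in_setU.
have [zS|] := boolP (z \in S); rewrite ?andbF // !andbT; congr (~~ (_ || _)).
apply/nbhdP/set1P => [[_ /set1P ->]|->]; first exact: onlyq.
by exists p; rewrite ?set11.
Qed.

Lemma alpha_in_leaf : alpha_in e S = (alpha_in e S').+1.
Proof.
have /leaf_inP[_ _ pq _] := leaf_pq.
apply/eqP; rewrite -add1n eqn_leq; apply/andP; split.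
  rewrite -{1}(setID S [set p; q]) (setIidPr leaf_sub).
  apply: leq_trans (leq_alpha_inU _ _ _) _; rewrite leq_add2r.
  have adj_pq : adj_in e [set p; q] p q by rewrite /adj_in /= set21 set22.
  have := ltn_nu_inD_edge adj_pq; have := leq_add_alpha_nu e [set p; q].
  by rewrite cards2 leaf_neq; lia.
have indp : independent e [set p].
  by apply/independentP => x y /set1P -> /set1P ->; rewrite e_irr.
rewrite -{1}(cards1 p) -(alpha_in_independent indp) -alpha_inU //.
- apply: alpha_inS; rewrite subUset subsetDl andbT.
  by rewrite (subset_trans _ leaf_sub) ?subsetUl.
- by rewrite disjoints1 !inE eqxx.
- exact: leaf_anticomplete.
Qed.

End Leaf.

Lemma konig_forest S : acyclic_in e S -> alpha_in e S + nu_in e S = #|S|.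
Proof.
move=> acS; apply/eqP; rewrite eqn_leq leq_add_alpha_nu //=.
move: S acS; apply: forest_ind => [S indS|S p q _ leaf_pq leS'].
  by rewrite alpha_in_independent // leq_addr.
have [adj_pq _] := andP leaf_pq.
have := ltn_nu_inD_edge adj_pq.
rewrite (card_leaf leaf_pq) (alpha_in_leaf leaf_pq); lia.
Qed.

Lemma alpha_in_matched S u : acyclic_in e S -> u \in S -> matched e S u ->
  alpha_in e (S :\ u) = alpha_in e S.
Proof.
move=> acS uS matched_u; apply/eqP; rewrite eqn_leq alpha_inS ?subD1set //=.
have lt_nu : nu_in e (S :\ u) < nu_in e S.
  rewrite ltn_neqAle nu_inS ?subD1set // andbT.
  by apply/eqP => /mismatched_nu_in.
have := konig_forest acS; have := konig_forest (acyclic_inS (subD1set S u) acS).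
have := cardsD1 u S; rewrite uS; lia.
Qed.

Lemma card_cover_matching S M : matching e S M -> #|cover M| = #|M| * 2.
Proof.
move=> mM; apply: card_uniform_partition (matching_partition mM).
have /andP[/subsetP sM _] := mM => m /sM/edges_inP[x [y [-> /and3P[_ _ xy]]]].
by rewrite cards2; case: eqVneq xy => // ->; rewrite e_irr.
Qed.

Lemma leq_card_forest S : acyclic_in e S -> #|S| <= 2 * alpha_in e S.
Proof.
move=> /konig_forest; have [M mM <-] := nu_inP e S.
have := subset_leq_card (matching_sub_cover mM).
rewrite (card_cover_matching mM); lia.
Qed.

End Forest.

Definition null_on (V : zmodType) (T : finType) (e : rel T) (S : {set T})
    (f : T -> V) : Prop :=
  {in S, forall y, \sum_(z in S | e y z) f z = 0}%R.

Section NullVectors.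
Local Open Scope ring_scope.
Variables (V : zmodType) (T : finType) (e : rel T).
Hypotheses (e_sym : symmetric e) (e_irr : irreflexive e).
Implicit Types (S : {set T}) (f : T -> V).

Lemma eq_null_on S f g : {in S, f =1 g} -> null_on e S f -> null_on e S g.
Proof.
move=> fg nf y yS; rewrite -[RHS](nf y yS).
by apply: eq_bigr => z /andP[zS _]; rewrite fg.
Qed.

Lemma null_on_component S w f : null_on e S f ->
  null_on e S (fun z => if connect (adj_in e S) w z then f z else 0).
Proof.
move=> nf y yS; have [wy|wy] := boolP (connect (adj_in e S) w y).
  rewrite -[RHS](nf y yS); apply: eq_bigr => z /andP[zS yz].
  by rewrite (connect_trans wy) // connect1 // /adj_in /= yS zS yz.
rewrite big1 // => z /andP[zS yz]; case: ifP => // wz.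
case/negP: wy; apply: connect_trans wz (connect1 _).
by rewrite /adj_in /= yS zS e_sym yz.
Qed.

Section Leaf.
Variables (S : {set T}) (p q : T).
Hypothesis leaf_pq : leaf_in e S p q.

Let S' := S :\: [set p; q].

Lemma sum_leaf (P : pred T) f : \sum_(z in S | P z) f z =
  (if P p then f p else 0) +
  ((if P q then f q else 0) + \sum_(z in S' | P z) f z).
Proof.
have /leaf_inP[pS qS _ _] := leaf_pq.
rewrite !big_mkcondr (bigD1 p) //= (bigD1 q) /=; last first.
  by rewrite qS eq_sym (leaf_neq e_irr leaf_pq).
congr (_ + (_ + _)); apply: eq_bigl => z.
by rewrite !inE negb_or [RHS]andbC andbA.
Qed.

Lemma null_on_leaf f : null_on e S f <->
  [/\ f q = 0, f p = - \sum_(z in S' | e q z) f z & null_on e S' f].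
Proof.
have /leaf_inP[pS qS pq _] := leaf_pq.
have pS' z : z \in S' -> e p z = false.
  by move=> zS'; apply/negbTE/(leaf_anticomplete leaf_pq); rewrite ?set11.
have sum_p : \sum_(z in S | e p z) f z = f q.
  by rewrite sum_leaf e_irr pq add0r big1 ?addr0 // => z /andP[/pS' ->].
have sum_q : \sum_(z in S | e q z) f z = f p + \sum_(z in S' | e q z) f z.
  by rewrite sum_leaf e_irr e_sym pq add0r.
have sum_S' y : f q = 0 -> y \in S' ->
    \sum_(z in S | e y z) f z = \sum_(z in S' | e y z) f z.
  by move=> fq /pS'; rewrite sum_leaf fq e_sym => ->; rewrite if_same !add0r.
split=> [nf|[fq fp nf] y yS].
  have fq : f q = 0 by rewrite -sum_p nf.
  split=> [//||y yS']; last by rewrite -sum_S' ?nf //; case/setDP: yS'.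
  by apply/eqP; rewrite -addr_eq0 -sum_q nf.
have [->|yp] := eqVneq y p; first by rewrite sum_p.
have [->|yq] := eqVneq y q; first by rewrite sum_q fp addNr.
have yS' : y \in S' by rewrite !inE negb_or yp yq.
by rewrite sum_S' ?nf.
Qed.

Lemma null_on_leaf_extend f : null_on e S' f ->
  exists g, [/\ null_on e S g, {in S', g =1 f}
    & g p = - \sum_(z in S' | e q z) f z].
Proof.
move=> nf.
pose g z := if z == q then 0 else
  if z == p then - \sum_(z in S' | e q z) f z else f z.
have gE : {in S', g =1 f}.
  by move=> z; rewrite !inE negb_or /g => /andP[/andP[/negbTE -> /negbTE ->]].
have gp : g p = - \sum_(z in S' | e q z) f z.
  by rewrite /g (negbTE (leaf_neq e_irr leaf_pq)) eqxx.
exists g; split=> //; apply/null_on_leaf; split; first by rewrite /g eqxx.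
  by rewrite gp; congr (- _); apply: eq_bigr => z /andP[/gE ->].
by apply: eq_null_on nf => z /gE.
Qed.

End Leaf.

End NullVectors.

Section Support.
Local Open Scope ring_scope.
Variables (R : realType) (T : finType) (e : rel T).
Hypotheses (e_sym : symmetric e) (e_irr : irreflexive e).
Implicit Types (S : {set T}) (f : T -> R).

Lemma suppP S x :
  reflect (exists f, [/\ x \in S, null_on e S f & f x != 0]) (x \in supp R e S).
Proof.
have adj_sum i (g : T -> R) : \sum_(z in S | e (enum_val i) z) g z =
    \sum_j adjmx R e S i j * g (enum_val j).
  rewrite big_mkcondr big_enum_val; apply: eq_bigr => j _.
  by rewrite mxE; case: (e _ _); rewrite ?mul1r ?mul0r.
apply: (iffP imsetP) => [[i]|[f [xS nf fx]]].
  rewrite inE => /asboolP[v /matrixP Av vi] ->.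
  exists (fun z => v (enum_rank_in (enum_valP i) z) 0); split.
  - exact: enum_valP.
  - move=> y yS; rewrite -(enum_rankK_in yS yS) adj_sum.
    under eq_bigr do rewrite enum_valK_in.
    by have := Av (enum_rank_in yS y) 0; rewrite !mxE.
  - by rewrite enum_valK_in.
exists (enum_rank_in xS x); last by rewrite enum_rankK_in.
rewrite inE; apply/asboolP; exists (\col_j f (enum_val j)).
  apply/matrixP => i j; rewrite !mxE -[RHS](nf _ (enum_valP i)) adj_sum.
  by apply: eq_bigr => k _; rewrite !mxE.
by rewrite mxE enum_rankK_in.
Qed.

Lemma supp_sub S : supp R e S \subset S.
Proof. by apply/subsetP => x /suppP[f []]. Qed.

Lemma supp_independent S : independent e S -> supp R e S = S.
Proof.
move=> /independentP indS; apply/eqP; rewrite eqEsubset supp_sub.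
apply/subsetP => x xS; apply/suppP; exists (fun=> 1); split=> //.
  move=> y yS; rewrite big1 // => z /andP[zS].
  by rewrite (negbTE (indS y z yS zS)).
exact: oner_neq0.
Qed.

Lemma N_forestE S : N_forest R e S = S :\: (supp R e S :|: nbhd e (supp R e S)).
Proof.
by apply/setP => x; rewrite !inE; case: (x \in S); rewrite ?andbF ?andbT.
Qed.

Section Leaf.
Variables (S : {set T}) (p q : T).
Hypothesis leaf_pq : leaf_in e S p q.

Let S' := S :\: [set p; q].

Lemma mem_supp_leaf x : x \in S' -> (x \in supp R e S) = (x \in supp R e S').
Proof.
move=> xS'; have [xS _] := setDP xS'.
apply/suppP/suppP => -[f [_ nf fx]].
  by exists f; split=> //; case/(null_on_leaf e_sym e_irr leaf_pq): nf.
have [g [ng gE _]] := null_on_leaf_extend e_sym e_irr leaf_pq nf.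
by exists g; rewrite gE.
Qed.

Lemma leaf_neighbour_notin_supp : q \notin supp R e S.
Proof.
apply/suppP => -[f [_ /(null_on_leaf e_sym e_irr leaf_pq)[-> _ _]]].
by rewrite eqxx.
Qed.

Lemma leaf_in_supp : acyclic_in e S ->
  (p \in supp R e S) = (q \in nbhd e (supp R e S')).
Proof.
have /leaf_inP[pS qS _ _] := leaf_pq.
move=> acS; apply/suppP/nbhdP => [[f [_ nf]]|[w /suppP[f [wS' nf fw]] wq]].
  have [_ -> nf'] := (null_on_leaf e_sym e_irr leaf_pq f).1 nf.
  move=> sum_neq0; apply: contrapT => no_nbr; case/eqP: sum_neq0.
  rewrite big1 ?oppr0 // => z /andP[zS' qz]; apply: contrapT => /eqP fz.
  by apply: no_nbr; exists z; rewrite 1?e_sym //; apply/suppP; exists f.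
(* Distinct neighbours of [q] lie in distinct components of [S'], so a null
   vector cut down to the component of [w] has a single term in the equation
   at [q]. *)
have nfw := null_on_component e_sym w nf.
have [g [ng _ gp]] := null_on_leaf_extend e_sym e_irr leaf_pq nfw.
exists g; split=> //; rewrite gp oppr_eq0.
rewrite (bigD1 w) /=; last by rewrite wS' e_sym.
rewrite connect0 big1 ?addr0 // => z /andP[/andP[zS' qz] zw].
case: ifP => // wz; exfalso.
have disqS' : [disjoint [set q] & S'] by rewrite disjoints1 !inE eqxx orbT.
have [|||c c_cycle [_ cS]] :=
  disjoint_links_cycle disqS' (set11 q) wS' (connect0 _ q) wz.
- by rewrite e_sym.
- by rewrite e_sym.
- by rewrite eq_sym zw orbT.
apply: (acS c c_cycle) => x /cS /setUP[/set1P -> //|].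
by move=> /setDP[].
Qed.

Lemma supp_leaf : acyclic_in e S ->
  supp R e S = if q \in nbhd e (supp R e S') then p |: supp R e S'
               else supp R e S'.
Proof.
move=> acS; rewrite -(leaf_in_supp acS); apply/setP => z.
have [zS'|zS'] := boolP (z \in S').
  rewrite mem_supp_leaf //; case: ifP; rewrite ?in_setU1 //.
  by case: eqVneq => // zp; rewrite zp !inE eqxx in zS'.
have zNs' : (z \in supp R e S') = false.
  by apply: contraNF zS' => /(subsetP (supp_sub _)).
transitivity ((z == p) && (p \in supp R e S)); last first.
  by case: ifP; rewrite ?in_setU1 zNs' ?orbF ?andbT ?andbF.
have [-> //|zp] := eqVneq z p; apply: contraNF zS' => zsupp.
rewrite !inE negb_or zp (subsetP (supp_sub S)) // andbT.
by apply: contraTneq zsupp => ->; apply: leaf_neighbour_notin_supp.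
Qed.

Lemma N_forest_leaf : acyclic_in e S ->
  N_forest R e S = if q \in nbhd e (supp R e S') then N_forest R e S'
                   else [set p; q] :|: N_forest R e S'.
Proof.
move=> acS; rewrite !N_forestE supp_leaf //; case: ifPn => q_nbr.
  by rewrite nbhdU setUACA -setDDl (leaf_setD_closed_nbhd leaf_pq).
have sS' := subsetP (supp_sub S').
rewrite -{1}(setID S [set p; q]) (setIidPr (leaf_sub leaf_pq)) setDUl.
congr (_ :|: _).
apply/setDidPl; rewrite disjoints_subset subUset !sub1set !in_setC !in_setU.
rewrite (negbTE q_nbr) orbF negb_or -andbA; apply/and3P; split.
- by apply/negP => /sS'; rewrite !inE eqxx.
- apply/nbhdP => -[v /sS' vS']; apply/negP.
  by rewrite e_sym (leaf_anticomplete leaf_pq) ?set11.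
- by apply/negP => /sS'; rewrite !inE eqxx orbT.
Qed.

Lemma card_supp_N_forest_leaf : acyclic_in e S ->
  (2 * #|supp R e S| + #|N_forest R e S| =
   (2 * #|supp R e S'| + #|N_forest R e S'|).+2)%N.
Proof.
move=> acS; rewrite supp_leaf // N_forest_leaf //; case: ifP => _.
  have p_notin : p \notin supp R e S'.
    by apply/negP => /(subsetP (supp_sub S')); rewrite !inE eqxx.
  by rewrite cardsU1 p_notin mulnDr.
rewrite cardsU cards2 (leaf_neq e_irr leaf_pq) disjoint_setI0 ?cards0 ?subn0.
  by rewrite addnCA.
rewrite disjoint_sym disjoints_subset N_forestE.
exact: subset_trans (subsetDl _ _) (subsetDr _ _).
Qed.

End Leaf.

Lemma alpha_in_forest S : acyclic_in e S ->
  (2 * alpha_in e S = 2 * #|supp R e S| + #|N_forest R e S|)%N.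
Proof.
move: S; apply: (forest_ind e_sym e_irr) => [S indS|S p q acS leaf_pq IHS].
  rewrite alpha_in_independent // N_forestE supp_independent //.
  by rewrite setDUr setDv set0I cards0 addn0.
rewrite (alpha_in_leaf e_sym e_irr leaf_pq).
by rewrite (card_supp_N_forest_leaf leaf_pq acS) -IHS mulnS.
Qed.

End Support.

Section PendantTree.
Variables (T : finType) (e : rel T).
Hypothesis e_sym : symmetric e.
Variables (C : {set T}) (v : T).
Hypothesis vC : v \in C.

Let P := pendant_tree e C v.

Lemma pendant_treeP : [/\ connected_in e P, P :&: C = [set v] &
  forall S, connected_in e S -> S :&: C = [set v] -> #|S| <= #|P|].
Proof.
rewrite /P /pendant_tree; case: arg_maxnP => [|S /andP[conS /eqP SC] maxS].
  apply/andP; split; last by rewrite (setIidPl _) // sub1set.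
  apply/andP; split; first by apply/set0Pn; exists v; rewrite inE.
  by apply/'forall_in_forall_inP => x /set1P -> y /set1P ->.
by split=> // S' conS' S'C; apply: maxS; rewrite conS' S'C eqxx.
Qed.

Lemma pendant_tree_root : v \in P.
Proof.
by have [_ /setP/(_ v)] := pendant_treeP; rewrite !inE eqxx => /andP[].
Qed.

Lemma pendant_treeD1_sub : P :\ v \subset ~: C.
Proof.
have [_ PC _] := pendant_treeP; apply/subsetP => x /setD1P[xv xP].
by rewrite inE; apply: contra xv => xC; rewrite -in_set1 -PC inE xP.
Qed.

Lemma pendant_tree_closed x y : x \in P -> y \notin C -> e x y -> y \in P.
Proof.
have [conP PC maxP] := pendant_treeP => xP yC xy.
have : #|y |: P| <= #|P|.
  apply: maxP; first exact: connected_inU1 xy.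
  by rewrite setIUl PC disjoint_setI0 ?set0U // disjoints1.
by rewrite cardsU1; case: (y \in P) => //; rewrite ltnn.
Qed.

Lemma component_sub_pendant_tree K u : K \in components e (~: C) ->
  u \in K -> e u v -> K \subset P.
Proof.
move=> cK uK uv; have KC := subsetP (component_sub cK).
have uP : u \in P.
  apply: pendant_tree_closed pendant_tree_root _ _; last by rewrite e_sym.
  by rewrite -in_setC KC.
have closedP : closed (adj_in e (~: C)) (mem P).
  move=> a b /and3P[]; rewrite !in_setC => aC bC ab; apply/idP/idP => inP.
    exact: pendant_tree_closed inP bC ab.
  by apply: pendant_tree_closed inP aC _; rewrite e_sym.
apply/subsetP => z; rewrite (mem_component e_sym z cK uK) => /andP[_ uz].
by rewrite -[z \in P](closed_connect closedP uz).
Qed.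

Lemma pendant_tree_attachment_matched K u : mismatched e P v ->
  K \in components e (~: C) -> u \in K -> e u v -> matched e K u.
Proof.
move=> mis cK uK uv.
apply: (mismatched_neighbour_matched e_sym pendant_tree_root mis _ _ uK uv).
  rewrite subsetD1 (component_sub_pendant_tree cK uK uv).
  by apply/negP => /(subsetP (component_sub cK)); rewrite inE vC.
apply: (anticompleteS (subxx K) _ (component_anticomplete e_sym cK)).
exact: setSD pendant_treeD1_sub.
Qed.

End PendantTree.

Lemma cover_cycle_edges (T : finType) (c : seq T) :
  cover (cycle_edges c) = [set x in c].
Proof.
apply/setP => z; rewrite inE; apply/bigcupP/idP => [[_ /imsetP[x xc ->]]|zc].
  by rewrite !inE => /orP[] /eqP -> //; rewrite mem_next.
by exists [set z; next c z]; [apply/imsetP; exists z|rewrite set21].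
Qed.

Lemma connect_in_cycle (T : finType) (e : rel T) (c : seq T) : cycle e c ->
  {in c &, forall x y, connect (adj_in e [set z in c]) x y}.
Proof.
move=> c_cycle; apply: connect_cycle.
apply: (@sub_in_cycle _ (mem c) e) c_cycle; last exact/allP.
by move=> a b aC bC ab; rewrite /adj_in /= !inE; apply/and3P.
Qed.

(* The successors along the cycle of an independent set lie outside of it. *)
Lemma leq_alpha_in_cycle (T : finType) (e : rel T) (c : seq T) : ucycle e c ->
  2 * alpha_in e [set x in c] <= #|[set x in c]|.
Proof.
move=> /andP[c_cycle c_uniq]; set C := [set x in c].
have [A /andP[AC /independentP indA] <-] := alpha_inP e C.
rewrite -(cardsID A C) (setIidPr AC) mul2n -addnn leq_add2l.
rewrite -(card_imset (mem A) (can_inj (prev_next c_uniq))).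
apply/subset_leq_card/subsetP => _ /imsetP[x xA ->].
have xc : x \in c by have := subsetP AC x xA; rewrite inE.
rewrite !inE mem_next xc andbT; apply/negP => nA.
by have := indA x _ xA nA; rewrite next_cycle.
Qed.

Section Unicyclic.
Variables (T : finType) (e : rel T).
Hypotheses (e_sym : symmetric e) (e_irr : irreflexive e).
Variable c : seq T.
Hypothesis c_cycle : graph_cycle e c.
Hypothesis c_unique :
  forall c', graph_cycle e c' -> cycle_edges c' = cycle_edges c.

Let C := [set x in c].

Lemma unicyclic_cycle_vertices c' : graph_cycle e c' -> [set x in c'] = C.
Proof.
by move=> /c_unique eqc; rewrite -cover_cycle_edges eqc cover_cycle_edges.
Qed.

Lemma unicyclic_acyclic_in (S : {set T}) : ~~ (C \subset S) -> acyclic_in e S.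
Proof.
move=> CnS c' /unicyclic_cycle_vertices c'C sub; case/negP: CnS.
by rewrite -c'C; apply/subsetP => x; rewrite inE => /sub.
Qed.

Lemma cycle_nonempty : exists x, x \in C.
Proof.
rewrite /C; case: c_cycle; case: c => // x s _ _.
by exists x; rewrite inE mem_head.
Qed.

Lemma unicyclic_acyclicC : acyclic_in e (~: C).
Proof.
have [x xC] := cycle_nonempty; apply/unicyclic_acyclic_in/subsetPn.
by exists x; rewrite // inE xC.
Qed.

(* Deleting one vertex of [C] leaves a forest, so that the lower bound does not
   require [C] to be chordless. *)
Lemma alpha_in_unique_cycle : alpha_in e C = #|C| %/ 2.
Proof.
have [x xC] := cycle_nonempty.
have acCx : acyclic_in e (C :\ x).
  by apply/unicyclic_acyclic_in/subsetPn; exists x; rewrite // !inE eqxx.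
have le_alpha : 2 * alpha_in e C <= #|C|.
  by apply: leq_alpha_in_cycle; case: c_cycle.
have := leq_card_forest e_sym e_irr acCx.
have := alpha_inS e (subD1set C x); have := cardsD1 x C; rewrite xC; lia.
Qed.

Lemma unicyclic_attachment_unique K u u' : K \in components e (~: C) ->
  u \in K -> u \in nbhd e C -> u' \in K -> u' \in nbhd e C -> u = u'.
Proof.
move=> cK uK /nbhdP[v vC vu] u'K /nbhdP[v' v'C v'u'].
have uC := subsetP (component_sub cK) u uK.
have uu' : connect (adj_in e (~: C)) u u'.
  by move: u'K; rewrite (mem_component e_sym _ cK uK) => /andP[].
have v'v : connect (adj_in e C) v' v.
  have [_ /andP[/connect_in_cycle conC _]] := c_cycle.
  by move: v'C vC; rewrite !inE; apply: conC.
have disC : [disjoint ~: C & C] by rewrite disjoints_subset.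
apply/eqP/negPn/negP => neq.
have [|||c' c'_cycle [uc' _]] := disjoint_links_cycle disC uC v'C uu' v'v.
- by rewrite e_sym.
- by [].
- by rewrite neq.
by move: uC; rewrite -(unicyclic_cycle_vertices c'_cycle) !inE uc'.
Qed.

Hypothesis c_typeII : typeII e C.

Lemma alpha_in_componentD_nbhd K : K \in components e (~: C) ->
  alpha_in e (K :\: nbhd e C) = alpha_in e K.
Proof.
move=> cK; have [K_nbhd|[u uKN]] := set_0Vmem (K :&: nbhd e C).
  by rewrite -[RHS](congr1 (alpha_in e) (setID K (nbhd e C))) K_nbhd set0U.
have /setIP[uK uN] := uKN; have /nbhdP[v vC vu] := uN.
have -> : K :\: nbhd e C = K :\ u.
  apply/setP => x; rewrite !in_setD in_set1.
  have [xK|] := boolP (x \in K); rewrite ?andbF // !andbT; congr (~~ _).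
  apply/idP/eqP => [xN|-> //].
  exact: unicyclic_attachment_unique cK xK xN uK uN.
apply: alpha_in_matched => //.
  exact: acyclic_inS (component_sub cK) unicyclic_acyclicC.
apply: (pendant_tree_attachment_matched e_sym vC _ cK uK); last first.
  by rewrite e_sym.
by apply: contrapT => matched_v; apply: c_typeII; exists v.
Qed.

Lemma alpha_typeII :
  alpha e = alpha_in e C + \sum_(K in components e (~: C)) alpha_in e K.
Proof.
have sum_alpha (A : {set T}) : A \subset ~: C ->
    alpha_in e A = \sum_(K in components e (~: C)) alpha_in e (A :&: K).
  apply: alpha_in_partition => //; first exact: component_partition.
  exact: components_pairwise_anticomplete.
pose D := ~: C :\: nbhd e C.
have alphaD : alpha_in e D = alpha_in e (~: C).
  rewrite !sum_alpha ?subsetDl //; apply: eq_bigr => K cK.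
  have /setIidPr KC := component_sub cK.
  by rewrite /D setIDAC KC alpha_in_componentD_nbhd.
have -> : \sum_(K in components e (~: C)) alpha_in e K = alpha_in e (~: C).
  rewrite sum_alpha //; apply: eq_bigr => K cK.
  by rewrite (setIidPr (component_sub cK)).
rewrite -alpha_in_setT; apply/eqP; rewrite eqn_leq; apply/andP; split.
  by rewrite -(setUCr C) leq_alpha_inU.
rewrite -alphaD -alpha_inU ?alpha_inS ?subsetT //; last first.
  exact: anticomplete_nbhd.
by rewrite disjoint_sym disjoints_subset subsetDl.
Qed.

End Unicyclic.

Local Open Scope ring_scope.

Theorem theorem4p9 (R : realType) (T : finType) (e : rel T)
    (e_sym : symmetric e) (e_irr : irreflexive e)
    (e_unicyclic : unicyclic e)
    (c : seq T) (c_cycle : graph_cycle e c)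
    (e_typeII : typeII e [set x in c]) :
  (alpha e)%:R =
    (#|[set x in c]| %/ 2)%:R +
    \sum_(K in components e (~: [set x in c]))
       (#|supp R e K|%:R + #|N_forest R e K|%:R / 2%:R) :> R.
Proof.
have c_unique c' : graph_cycle e c' -> cycle_edges c' = cycle_edges c.
  by case: e_unicyclic => _ [c0 _ uniq0] /uniq0 ->; rewrite (uniq0 c).
rewrite (alpha_typeII e_sym e_irr c_cycle c_unique e_typeII).
rewrite (alpha_in_unique_cycle e_sym e_irr c_cycle c_unique) natrD natr_sum.
congr (_ + _); apply: eq_bigr => K cK.
have acK : acyclic_in e K.
  exact: acyclic_inS (component_sub cK) (unicyclic_acyclicC c_cycle c_unique).
have two_neq0 : 2%:R != 0 :> R by rewrite pnatr_eq0.
apply: (mulfI two_neq0); rewrite mulrDr mulrCA divff // mulr1.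
by rewrite -!natrM -natrD (alpha_in_forest R e_sym e_irr acK).
Qed.
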